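(* Let $(R,\mathfrak m)$ be a local ring with positive depth. Then $R$ satisfies (SAC) if and only if $R$ satisfies (SACC).
   Context: All rings are commutative Noetherian with identity. A ring $R$ satisfies (SAC) if for each finitely generated $R$-module $M$: whenever $\mathrm{Ext}_R^i(M,R)=0$ for all $i>0$ and $\mathrm{Ext}_R^i(M,M)=0$ for all sufficiently large $i$, one has $\mathrm{Ext}_R^i(M,M)=0$ for all $i>0$. A ring $R$ satisfies (SACC) if the same implication holds for each finitely generated $R$-module $M$ that has constant rank. A finitely generated $R$-module $M$ has constant rank $r$ if $M\otimes_R Q$ is a free $Q$-module of rank $r$, where $Q$ is the total ring of fractions of $R$. *)

(* Defs.v *)
From HB Require Import structures.
From mathcomp Require Import all_boot all_algebra generic_quotient ring.
From mathcomp Require Import boolp classical_sets.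
From mathcomp Require Import freeg.

Set Implicit Arguments.
Unset Strict Implicit.
Unset Printing Implicit Defensive.

Import GRing.Theory.
Local Open Scope ring_scope.
Local Open Scope quotient_scope.

Section Ideals.
Variable R : comNzRingType.
Implicit Types (I m : set R) (s : seq R).

Definition is_ideal I : Prop :=
  I 0 /\ forall a x y, I x -> I y -> I (a * x + y).

Definition ideal_gen s : set R :=
  [set a | exists c : 'I_(size s) -> R, a = \sum_i c i * s`_i].

Definition noetherian : Prop :=
  forall I, is_ideal I -> exists s, I = ideal_gen s.

Definition maximal_ideal m : Prop :=
  [/\ is_ideal m, ~ m 1 &
      forall I, is_ideal I -> (m `<=` I)%classic -> ~ I 1 -> I = m].

Definition local_ring m : Prop :=
  maximal_ideal m /\ forall m', maximal_ideal m' -> m' = m.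

(* The second conjunct says that s`_i is a nonzerodivisor on
   R / (s`_0, ..., s`_(i-1)). *)
Definition regular_sequence s : Prop :=
  ~ ideal_gen s 1 /\
  forall i, (i < size s)%N -> forall a,
    ideal_gen (take i s) (s`_i * a) -> ideal_gen (take i s) a.

Definition regular_in m s : Prop :=
  regular_sequence s /\ forall x, x \in s -> m x.

Definition has_depth m (d : nat) : Prop :=
  (exists2 s, regular_in m s & size s = d) /\
  (forall s, regular_in m s -> (size s <= d)%N).

End Ideals.

Section Submodule.
Variables (R : pzRingType) (V : lmodType R).

Record submodule (S : submodClosed V) : Type :=
  Submodule { submodule_val : V; submodule_valP : submodule_val \in S }.

Variable S : submodClosed V.
HB.instance Definition _ := [isSub for @submodule_val S].
HB.instance Definition _ := [Choice of submodule S by <:].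
HB.instance Definition _ := [SubChoice_isSubLmodule of submodule S by <:].

End Submodule.

Section QuotientModule.
Variables (R : pzRingType) (V : lmodType R) (S : submodClosed V).

(* A submodClosed is not inferred to be a zmodClosed, as {ideal_quot _} needs. *)
Definition submod_pred : {pred V} := fun x => x \in S.
HB.instance Definition _ :=
  GRing.isZmodClosed.Build V submod_pred (GRing.submod_closedB (submodClosedP S)).

Definition quotmod : Type := {ideal_quot submod_pred}.
HB.instance Definition _ := GRing.Zmodule.on quotmod.
HB.instance Definition _ := Quotient.on quotmod.

Definition quotmod_pi (x : V) : quotmod := \pi_({ideal_quot submod_pred}) x.

Definition quotmod_scale (a : R) (x : quotmod) : quotmod :=
  quotmod_pi (a *: repr x).

Lemma quotmod_piE (x y : V) : (quotmod_pi x == quotmod_pi y) = (x - y \in S).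
Proof. exact/esym/(Quotient.idealrBE submod_pred). Qed.

Lemma quotmod_piK (x : quotmod) : quotmod_pi (repr x) = x.
Proof. exact: reprK. Qed.

Lemma quotmod_piD : {morph quotmod_pi : x y / x + y}.
Proof. by move=> x y; rewrite /quotmod_pi !piE. Qed.

Lemma quotmod_scale_pi a x : quotmod_scale a (quotmod_pi x) = quotmod_pi (a *: x).
Proof.
apply/eqP; rewrite quotmod_piE -scalerBr rpredZ //.
by rewrite -quotmod_piE quotmod_piK.
Qed.

Fact quotmod_scaleA a b x :
  quotmod_scale a (quotmod_scale b x) = quotmod_scale (a * b) x.
Proof. by rewrite -(quotmod_piK x) !quotmod_scale_pi scalerA. Qed.

Fact quotmod_scale1 : left_id 1 quotmod_scale.
Proof. by move=> x; rewrite -(quotmod_piK x) quotmod_scale_pi scale1r. Qed.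

Fact quotmod_scaleDr : right_distributive quotmod_scale +%R.
Proof.
move=> a x y; rewrite -(quotmod_piK x) -(quotmod_piK y) -quotmod_piD.
by rewrite !quotmod_scale_pi -quotmod_piD scalerDr.
Qed.

Fact quotmod_scaleDl x : {morph quotmod_scale^~ x : a b / a + b}.
Proof.
move=> a b; rewrite -(quotmod_piK x).
by rewrite !quotmod_scale_pi -quotmod_piD scalerDl.
Qed.

HB.instance Definition _ := GRing.Zmodule_isLmodule.Build R quotmod
  quotmod_scaleA quotmod_scale1 quotmod_scaleDr quotmod_scaleDl.

Fact quotmod_pi_linear : linear quotmod_pi.
Proof. by move=> a x y; rewrite quotmod_piD -quotmod_scale_pi. Qed.
HB.instance Definition _ :=
  GRing.isLinear.Build R V quotmod *:%R quotmod_pi quotmod_pi_linear.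

Lemma quotmod_pi_eq0 x : (quotmod_pi x == 0) = (x \in S).
Proof. by rewrite -[0](linear0 quotmod_pi) quotmod_piE subr0. Qed.

End QuotientModule.

Section Span.
Variables (R : pzRingType) (V : lmodType R) (A : set V).

Definition lspan : {pred V} := fun x =>
  `[< forall S : submodClosed V, (forall y, A y -> y \in S) -> x \in S >].

Fact lspan_closed : GRing.subsemimod_closed lspan.
Proof.
split; first split.
- by apply/asboolP => S _; exact: rpred0.
- move=> x y /asboolP hx /asboolP hy; apply/asboolP => S hS.
  by rewrite rpredD ?hx ?hy.
- by move=> a x /asboolP hx; apply/asboolP => S hS; rewrite rpredZ ?hx.
Qed.

HB.instance Definition _ := GRing.isSubmodClosed.Build R V lspan lspan_closed.

End Span.

Section Hom.
Variables (R : comNzRingType) (U V : lmodType R).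
Local Notation Hom := {linear U -> V}.
Implicit Types f g h : Hom.

Lemma linear_ext f g : f =1 g -> f = g.
Proof.
move=> /funext; case: f g => [f [[fD] [fZ]]] [g [[gD] [gZ]]] /= efg.
subst g; congr (GRing.Linear.Pack (GRing.Linear.Class _ _)).
- by rewrite (Prop_irrelevance fD gD).
- by rewrite (Prop_irrelevance fZ gZ).
Qed.

HB.instance Definition _ := gen_eqMixin Hom.
HB.instance Definition _ := gen_choiceMixin Hom.

Definition hom_zero : Hom := \0.
Definition hom_opp f : Hom := \- f.
Definition hom_add f g : Hom := f \+ g.
Definition hom_scale (a : R) f : Hom := a \*: f.

Fact hom_addA : associative hom_add.
Proof. by move=> f g h; apply: linear_ext => x /=; rewrite addrA. Qed.
Fact hom_addC : commutative hom_add.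
Proof. by move=> f g; apply: linear_ext => x /=; rewrite addrC. Qed.
Fact hom_add0 : left_id hom_zero hom_add.
Proof. by move=> f; apply: linear_ext => x /=; rewrite add0r. Qed.
Fact hom_addN : left_inverse hom_zero hom_opp hom_add.
Proof. by move=> f; apply: linear_ext => x /=; rewrite addNr. Qed.

HB.instance Definition _ :=
  GRing.isZmodule.Build Hom hom_addA hom_addC hom_add0 hom_addN.

Fact hom_scaleA a b f : hom_scale a (hom_scale b f) = hom_scale (a * b) f.
Proof. by apply: linear_ext => x /=; rewrite scalerA. Qed.
Fact hom_scale1 : left_id 1 hom_scale.
Proof. by move=> f; apply: linear_ext => x /=; rewrite scale1r. Qed.
Fact hom_scaleDr : right_distributive hom_scale +%R.
Proof. by move=> a f g; apply: linear_ext => x /=; rewrite scalerDr. Qed.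
Fact hom_scaleDl f : {morph hom_scale^~ f : a b / a + b}.
Proof. by move=> a b; apply: linear_ext => x /=; rewrite scalerDl. Qed.

HB.instance Definition _ := GRing.Zmodule_isLmodule.Build R Hom
  hom_scaleA hom_scale1 hom_scaleDr hom_scaleDl.

End Hom.

Section Homology.
Variable R : pzRingType.

Section Kernel.
Variables (U V : lmodType R) (f : {linear U -> V}).

Definition lkernel : {pred U} := fun x => f x == 0.

Lemma lkernelE x : (x \in lkernel) = (f x == 0). Proof. by []. Qed.

Fact lkernel_closed : GRing.subsemimod_closed lkernel.
Proof.
split; first split.
- by rewrite lkernelE raddf0.
- move=> x y; rewrite !lkernelE => /eqP fx /eqP fy.
  by rewrite linearD fx fy addr0.
- move=> a x; rewrite !lkernelE => /eqP fx.
  by rewrite linearZ /= fx scaler0.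
Qed.

HB.instance Definition _ := GRing.isSubmodClosed.Build R U lkernel lkernel_closed.

End Kernel.

Section Middle.
Variables (U V W : lmodType R) (f : {linear U -> V}) (g : {linear V -> W}).

Definition boundary : {pred submodule (lkernel g)} :=
  fun z => `[< exists u, f u = val z >].

Fact boundary_closed : GRing.subsemimod_closed boundary.
Proof.
split; first split.
- by apply/asboolP; exists 0; rewrite raddf0.
- move=> x y /asboolP[u fu] /asboolP[v fv]; apply/asboolP.
  by exists (u + v); rewrite linearD fu fv.
- move=> a x /asboolP[u fu]; apply/asboolP.
  by exists (a *: u); rewrite linearZ /= fu.
Qed.

HB.instance Definition _ :=
  GRing.isSubmodClosed.Build R (submodule (lkernel g)) boundary boundary_closed.

(* ker g / (im f \cap ker g), which is ker g / im f when g \o f = 0. *)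
Definition homology : lmodType R := quotmod boundary.

End Middle.
End Homology.

Section FreeModule.
Variables (R : comNzRingType) (K : choiceType) (V : lmodType R) (f : K -> V).

Fact fglift_zmod : zmod_morphism (fglift f : {freeg K / R} -> V).
Proof. exact: lift_is_additive. Qed.
HB.instance Definition _ :=
  GRing.isZmodMorphism.Build {freeg K / R} V (fglift f) fglift_zmod.

Fact fglift_scalable : scalable (fglift f : {freeg K / R} -> V).
Proof.
move=> a x; rewrite -[in RHS](freeg_sumE x) -[a *: x]/(fgscale a x) /fgscale.
rewrite !raddf_sum /=; apply: eq_bigr => z _.
by rewrite !liftU scalerA.
Qed.
HB.instance Definition _ :=
  GRing.isScalable.Build R {freeg K / R} V *:%R (fglift f) fglift_scalable.

End FreeModule.

Section Ext.
Variable R : comNzRingType.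

(* The standard free resolution of M:
     F_n = free module on the underlying set of K_n,
     K_0 = M,  K_(n+1) = ker (F_n -> K_n),
   with differential F_(n+1) -> K_(n+1) -> F_n. *)
Definition free_cover (M : lmodType R) : {linear {freeg M / R} -> M} :=
  fglift (@id M).

Fixpoint syzygy (M : lmodType R) (n : nat) : lmodType R :=
  if n is n'.+1 then submodule (lkernel (free_cover (syzygy M n'))) else M.

Definition free_res (M : lmodType R) (n : nat) : lmodType R :=
  {freeg (syzygy M n) / R}.

Definition free_res_d (M : lmodType R) (n : nat) :
    {linear free_res M n.+1 -> free_res M n} :=
  (val : {linear syzygy M n.+1 -> free_res M n}) \o free_cover (syzygy M n.+1).

Lemma free_cover_gen (M : lmodType R) (x : M) : free_cover M << x >> = x.
Proof. by rewrite /free_cover /= liftU scale1r. Qed.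

Lemma free_res_dP (M : lmodType R) (n : nat) (z : free_res M n) :
  (exists w, free_res_d M n w = z) <-> free_cover (syzygy M n) z = 0.
Proof.
split=> [[w <-]|z0].
  exact/eqP/(submodule_valP (free_cover (syzygy M n.+1) w)).
have zK : z \in lkernel (free_cover (syzygy M n)) by apply/eqP.
exists << (Submodule zK : syzygy M n.+1) >>.
by rewrite /free_res_d [LHS]/= free_cover_gen.
Qed.

Section Precomposition.
Variables (U V N : lmodType R) (d : {linear U -> V}).

Definition precomp (f : {linear V -> N}) : {linear U -> N} := f \o d.

Fact precomp_linear : linear precomp.
Proof. by move=> a f g; apply: linear_ext. Qed.
HB.instance Definition _ :=
  GRing.isLinear.Build R {linear V -> N} {linear U -> N} *:%R precomp
    precomp_linear.

End Precomposition.

Definition Ext_d (M N : lmodType R) (n : nat) :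
    {linear {linear free_res M n -> N} -> {linear free_res M n.+1 -> N}} :=
  precomp (free_res_d M n).

Definition Ext (i : nat) (M N : lmodType R) : lmodType R :=
  if i is j.+1 then homology (Ext_d M N j) (Ext_d M N j.+1)
  else homology (\0 : {linear N -> {linear free_res M 0 -> N}}) (Ext_d M N 0).

End Ext.

Section TotalFractions.
Variable R : comNzRingType.

Definition nonzerodivisor (s : R) : Prop := forall a, s * a = 0 -> a = 0.

Fact nonzerodivisor1 : nonzerodivisor 1.
Proof. by move=> a; rewrite mul1r. Qed.

Fact nonzerodivisorM s t :
  nonzerodivisor s -> nonzerodivisor t -> nonzerodivisor (s * t).
Proof. by move=> hs ht a; rewrite -mulrA => /hs/ht. Qed.

Fact nonzerodivisorI s a b : nonzerodivisor s -> s * a = s * b -> a = b.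
Proof.
by move=> hs /eqP; rewrite -subr_eq0 -mulrBr => /eqP/hs/eqP; rewrite subr_eq0
  => /eqP.
Qed.

Record tratio : Type := TRatio {
  tratio_val : R * R;
  tratio_valP : `[< nonzerodivisor tratio_val.2 >] }.
HB.instance Definition _ := [isSub for tratio_val].
HB.instance Definition _ := [Choice of tratio by <:].

Local Notation num x := (tratio_val x).1.
Local Notation den x := (tratio_val x).2.
Implicit Types x y z : tratio.

Fact denP x : nonzerodivisor (den x).
Proof. exact/asboolP/tratio_valP. Qed.
Arguments denP : clear implicits.

Definition mk_tratio (a s : R) (hs : nonzerodivisor s) : tratio :=
  @TRatio (a, s) (asboolT hs).

Definition eq_tratio : rel tratio := fun x y => num x * den y == num y * den x.

Fact eq_tratio_refl : reflexive eq_tratio.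
Proof. by move=> x; rewrite /eq_tratio. Qed.
Fact eq_tratio_sym : symmetric eq_tratio.
Proof. by move=> x y; rewrite /eq_tratio eq_sym. Qed.
Fact eq_tratio_trans : transitive eq_tratio.
Proof.
move=> y x z /eqP xy /eqP yz; apply/eqP; apply: (nonzerodivisorI (denP y)).
by rewrite mulrA [den y * _]mulrC xy mulrAC yz mulrAC mulrC mulrA.
Qed.

Canonical eq_tratio_equiv :=
  EquivRel eq_tratio eq_tratio_refl eq_tratio_sym eq_tratio_trans.

Definition totfrac : Type := {eq_quot eq_tratio}.
HB.instance Definition _ := Choice.on totfrac.

Definition totfrac_pi (x : tratio) : totfrac := \pi_({eq_quot eq_tratio}) x.

Lemma totfrac_piP x y :
  totfrac_pi x = totfrac_pi y <-> num x * den y = num y * den x.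
Proof.
split=> [|e]; first by move/eqmodP/eqP.
by apply/eqmodP; rewrite /= /eq_tratio e.
Qed.

Lemma totfrac_repr (q : totfrac) : totfrac_pi (repr q) = q.
Proof. exact: reprK. Qed.

Definition tfrac (a s : R) (hs : nonzerodivisor s) : totfrac :=
  totfrac_pi (mk_tratio a hs).

Lemma tfracP a s hs b t ht : @tfrac a s hs = @tfrac b t ht <-> a * t = b * s.
Proof. exact: totfrac_piP. Qed.

Lemma tfracW (P : totfrac -> Prop) :
  (forall a s (hs : nonzerodivisor s), P (tfrac a hs)) -> forall q, P q.
Proof.
move=> hP q; rewrite -(totfrac_repr q); case: (repr q) => -[a s] h.
by rewrite (bool_irrelevance h (asboolT (asboolW h))); exact: hP.
Qed.

Definition totfrac0 : totfrac := tfrac 0 nonzerodivisor1.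
Definition totfrac1 : totfrac := tfrac 1 nonzerodivisor1.
Definition totfrac_opp (p : totfrac) : totfrac :=
  tfrac (- num (repr p)) (denP (repr p)).
Definition totfrac_add (p q : totfrac) : totfrac :=
  tfrac (num (repr p) * den (repr q) + num (repr q) * den (repr p))
       (nonzerodivisorM (denP (repr p)) (denP (repr q))).
Definition totfrac_mul (p q : totfrac) : totfrac :=
  tfrac (num (repr p) * num (repr q))
       (nonzerodivisorM (denP (repr p)) (denP (repr q))).

Lemma tfrac_repr a s hs :
  num (repr (@tfrac a s hs)) * s = a * den (repr (@tfrac a s hs)).
Proof. exact/(totfrac_piP (repr (tfrac a hs)) (mk_tratio a hs))/totfrac_repr. Qed.

Lemma tfrac_opp a s hs : totfrac_opp (@tfrac a s hs) = tfrac (- a) hs.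
Proof. by apply/tfracP; rewrite !mulNr tfrac_repr. Qed.

Lemma tfrac_add a s hs b t ht :
  totfrac_add (@tfrac a s hs) (@tfrac b t ht) =
  tfrac (a * t + b * s) (nonzerodivisorM hs ht).
Proof.
apply/tfracP; have := tfrac_repr a hs; have := tfrac_repr b ht.
move: (tratio_val (repr (tfrac a hs))) (tratio_val (repr (tfrac b ht))).
move=> [c u] [d v] /= ed ec.
transitivity ((c * s) * (v * t) + (d * t) * (u * s)); first by ring.
by rewrite ec ed; ring.
Qed.

Lemma tfrac_mul a s hs b t ht :
  totfrac_mul (@tfrac a s hs) (@tfrac b t ht) =
  tfrac (a * b) (nonzerodivisorM hs ht).
Proof.
apply/tfracP; have := tfrac_repr a hs; have := tfrac_repr b ht.
move: (tratio_val (repr (tfrac a hs))) (tratio_val (repr (tfrac b ht))).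
move=> [c u] [d v] /= ed ec.
by rewrite mulrACA ec ed mulrACA.
Qed.

Fact totfrac_addA : associative totfrac_add.
Proof.
elim/tfracW=> a s hs; elim/tfracW=> b t ht; elim/tfracW=> c u hu.
by rewrite !tfrac_add; apply/tfracP; ring.
Qed.
Fact totfrac_addC : commutative totfrac_add.
Proof.
elim/tfracW=> a s hs; elim/tfracW=> b t ht.
by rewrite !tfrac_add; apply/tfracP; ring.
Qed.
Fact totfrac_add0 : left_id totfrac0 totfrac_add.
Proof. by elim/tfracW=> a s hs; rewrite tfrac_add; apply/tfracP; ring. Qed.
Fact totfrac_addN : left_inverse totfrac0 totfrac_opp totfrac_add.
Proof.
by elim/tfracW=> a s hs; rewrite tfrac_opp tfrac_add; apply/tfracP; ring.
Qed.

HB.instance Definition _ := GRing.isZmodule.Build totfrac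
  totfrac_addA totfrac_addC totfrac_add0 totfrac_addN.

Fact totfrac_mulA : associative totfrac_mul.
Proof.
elim/tfracW=> a s hs; elim/tfracW=> b t ht; elim/tfracW=> c u hu.
by rewrite !tfrac_mul; apply/tfracP; ring.
Qed.
Fact totfrac_mulC : commutative totfrac_mul.
Proof.
elim/tfracW=> a s hs; elim/tfracW=> b t ht.
by rewrite !tfrac_mul; apply/tfracP; ring.
Qed.
Fact totfrac_mul1 : left_id totfrac1 totfrac_mul.
Proof. by elim/tfracW=> a s hs; rewrite tfrac_mul; apply/tfracP; ring. Qed.
Fact totfrac_mulDl : left_distributive totfrac_mul totfrac_add.
Proof.
elim/tfracW=> a s hs; elim/tfracW=> b t ht; elim/tfracW=> c u hu.
by rewrite (@tfrac_add a s hs b t ht) !tfrac_mul tfrac_add; apply/tfracP; ring.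
Qed.
Fact totfrac_1neq0 : totfrac1 != totfrac0.
Proof. by apply/eqP => /tfracP/eqP; rewrite !mulr1 oner_eq0. Qed.

HB.instance Definition _ := GRing.Zmodule_isComNzRing.Build totfrac
  totfrac_mulA totfrac_mulC totfrac_mul1 totfrac_mulDl totfrac_1neq0.

Definition to_totfrac (a : R) : totfrac := tfrac a nonzerodivisor1.

Fact to_totfrac_zmod : zmod_morphism to_totfrac.
Proof.
move=> a b; rewrite /to_totfrac -[RHS]/(totfrac_add _ (totfrac_opp _)).
by rewrite tfrac_opp tfrac_add; apply/tfracP; ring.
Qed.
Fact to_totfrac_monoid : monoid_morphism to_totfrac.
Proof.
split=> // a b; rewrite /to_totfrac -[RHS]/(totfrac_mul _ _) tfrac_mul.
by apply/tfracP; ring.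
Qed.
HB.instance Definition _ :=
  GRing.isZmodMorphism.Build R totfrac to_totfrac to_totfrac_zmod.
HB.instance Definition _ :=
  GRing.isMonoidMorphism.Build R totfrac to_totfrac to_totfrac_monoid.

Definition totfrac_scale (a : R) (q : totfrac) : totfrac := to_totfrac a * q.
Fact totfrac_scaleA a b q :
  totfrac_scale a (totfrac_scale b q) = totfrac_scale (a * b) q.
Proof. by rewrite /totfrac_scale rmorphM mulrA. Qed.
Fact totfrac_scale1 : left_id 1 totfrac_scale.
Proof. by move=> q; rewrite /totfrac_scale rmorph1 mul1r. Qed.
Fact totfrac_scaleDr : right_distributive totfrac_scale +%R.
Proof. by move=> a p q; rewrite /totfrac_scale mulrDr. Qed.
Fact totfrac_scaleDl q : {morph totfrac_scale^~ q : a b / a + b}.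
Proof. by move=> a b; rewrite /totfrac_scale rmorphD mulrDl. Qed.

HB.instance Definition _ := GRing.Zmodule_isLmodule.Build R totfrac
  totfrac_scaleA totfrac_scale1 totfrac_scaleDr totfrac_scaleDl.

End TotalFractions.

Section Tensor.
Variables (R : comNzRingType) (M N : lmodType R).

Local Notation free := {freeg (M * N)%type / R}.
Local Notation gen x y := (<< (x, y) >> : free).

Variant tensor_relation : set free :=
| TensorDl x x' y : tensor_relation (gen (x + x') y - gen x y - gen x' y)
| TensorDr x y y' : tensor_relation (gen x (y + y') - gen x y - gen x y')
| TensorZl a x y : tensor_relation (gen (a *: x) y - a *: gen x y)
| TensorZr a x y : tensor_relation (gen x (a *: y) - a *: gen x y).

Definition tensor : lmodType R := quotmod (lspan tensor_relation).

Definition tensor_pi : {linear free -> tensor} :=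
  quotmod_pi (lspan tensor_relation).

Definition pure_tensor (x : M) (y : N) : tensor := tensor_pi (gen x y).

End Tensor.

Section TensorMap.
Variables (R : comNzRingType) (M N N' : lmodType R).
Implicit Types (g : {linear N -> N'}) (t : tensor M N).

Definition tensor_map_free g :
    {linear {freeg (M * N)%type / R} -> {freeg (M * N')%type / R}} :=
  fglift (fun p : M * N => << (p.1, g p.2) >>).

Definition tensor_map_pi g :
    {linear {freeg (M * N)%type / R} -> tensor M N'} :=
  tensor_pi M N' \o tensor_map_free g.

(* id_M (x) g *)
Definition tensor_map g t : tensor M N' := tensor_map_pi g (repr t).

Lemma lspan_gen (V : lmodType R) (A : set V) x : A x -> x \in lspan A.
Proof. by move=> Ax; apply/asboolP => S; apply. Qed.

Lemma tensor_map_pi_gen g x y : tensor_map_pi g << (x, y) >> = pure_tensor x (g y).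
Proof. by rewrite /tensor_map_pi /tensor_map_free /= liftU scale1r. Qed.

Lemma tensor_map_rel g z :
  z \in lspan (@tensor_relation R M N) -> tensor_map_pi g z = 0.
Proof.
have : forall w, tensor_relation w -> tensor_pi M N' w = 0.
  move=> w hw; apply/eqP.
  by rewrite [_ == _]quotmod_pi_eq0 lspan_gen.
have : forall x y, tensor_map_pi g << (x, y) >> = tensor_pi M N' << (x, g y) >>.
  exact: tensor_map_pi_gen.
move: (tensor_map_pi g) (tensor_pi M N') => h p hE p0.
move=> /asboolP/(_ (lkernel h)) hz; apply/eqP; apply: hz => w.
case=> [x x' y|x y y'|a x y|a x y]; apply/eqP.
- have := p0 _ (TensorDl x x' (g y)).
  by rewrite !(linearB p) !(linearB h) !hE.
- have := p0 _ (TensorDr x (g y) (g y')); rewrite -(linearD g).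
  by rewrite !(linearB p) !(linearB h) !hE.
- have := p0 _ (TensorZl a x (g y)).
  by rewrite (linearB p) (linearB h) (linearZ_LR p) (linearZ_LR h) !hE.
- have := p0 _ (TensorZr a x (g y)); rewrite -(linearZ_LR g).
  by rewrite (linearB p) (linearB h) (linearZ_LR p) (linearZ_LR h) !hE.
Qed.

Lemma tensor_mapE g z :
  tensor_map g (tensor_pi M N z) = tensor_map_pi g z.
Proof.
apply/eqP; rewrite -subr_eq0 -linearB; apply/eqP/tensor_map_rel.
by rewrite -quotmod_piE quotmod_piK.
Qed.

Lemma tensor_map_pure g x y : tensor_map g (pure_tensor x y) = pure_tensor x (g y).
Proof. by rewrite tensor_mapE tensor_map_pi_gen. Qed.

Fact tensor_map_linear g : linear (tensor_map g).
Proof.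
move=> a t u; rewrite -(quotmod_piK t) -(quotmod_piK u) -linearP /=.
by rewrite !tensor_mapE linearP.
Qed.

HB.instance Definition _ g :=
  GRing.isLinear.Build R (tensor M N) (tensor M N') *:%R (tensor_map g)
    (tensor_map_linear g).

(* Linear maps out of M (x) N are determined by their values on x (x) y. *)
Lemma tensor_ext (V : lmodType R) (h h' : {linear tensor M N -> V}) :
  (forall x y, h (pure_tensor x y) = h' (pure_tensor x y)) -> h =1 h'.
Proof.
move=> e t; rewrite -(quotmod_piK t).
rewrite -[quotmod_pi _ _]/(tensor_pi M N (repr t)) -(freeg_sumE (repr t)).
rewrite (linear_sum (tensor_pi M N)) (linear_sum h) (linear_sum h').
apply: eq_bigr => -[x y] _.
have this k : << k *g (x, y) >> = k *: << (x, y) >> :> {freeg (M * N)%type / R}.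
  by apply/eqP/freeg_eqP => w; rewrite coeffZ !coeffU mul1r.
rewrite this (linearZ_LR (tensor_pi M N)) (linearZ_LR h) (linearZ_LR h').
by congr (_ *: _); exact: e.
Qed.

End TensorMap.

Section BaseChange.
Variables (R : comNzRingType) (M : lmodType R).
Local Notation Q := (totfrac R).

Definition totfrac_mull (q p : Q) : Q := q * p.

Fact totfrac_mull_linear q : linear (totfrac_mull q).
Proof.
move=> a p p'; rewrite /totfrac_mull mulrDr; congr (_ + _).
by rewrite -[a *: p]/(to_totfrac a * p) mulrCA.
Qed.
HB.instance Definition _ q :=
  GRing.isLinear.Build R Q Q *:%R (totfrac_mull q) (totfrac_mull_linear q).

(* The Q-module M (x)_R Q, with q (x (x) p) = x (x) q p. *)
Definition totfrac_tensor : Type := tensor M Q.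
HB.instance Definition _ := GRing.Zmodule.on totfrac_tensor.

Definition totfrac_tensor_scale (q : Q) (t : totfrac_tensor) : totfrac_tensor :=
  tensor_map (totfrac_mull q) t.

Fact totfrac_tensor_scaleA q q' t :
  totfrac_tensor_scale q (totfrac_tensor_scale q' t) =
  totfrac_tensor_scale (q * q') t.
Proof.
apply: (tensor_ext (h := tensor_map (totfrac_mull q)
                       \o tensor_map (totfrac_mull q'))
                   (h' := tensor_map (totfrac_mull (q * q')))) => x p.
by rewrite /= !tensor_map_pure /= /totfrac_mull mulrA.
Qed.

Fact totfrac_tensor_scale1 : left_id 1 totfrac_tensor_scale.
Proof.
apply: (tensor_ext (h := tensor_map (totfrac_mull 1)) (h' := idfun)) => x p.
by rewrite /= tensor_map_pure /= /totfrac_mull mul1r.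
Qed.

Fact totfrac_tensor_scaleDr : right_distributive totfrac_tensor_scale +%R.
Proof. by move=> q t u; rewrite /totfrac_tensor_scale raddfD. Qed.

Fact totfrac_tensor_scaleDl t :
  {morph totfrac_tensor_scale^~ t : q q' / q + q'}.
Proof.
move=> q q'; move: t.
apply: (tensor_ext (h := tensor_map (totfrac_mull (q + q')))
   (h' := tensor_map (totfrac_mull q) \+ tensor_map (totfrac_mull q'))) => x p.
rewrite /= !tensor_map_pure /= /totfrac_mull mulrDl; apply/eqP.
rewrite -subr_eq0 opprD addrA -!(linearB (tensor_pi M Q)) [_ == _]quotmod_pi_eq0.
exact/lspan_gen/(TensorDr x (q * p : Q) (q' * p : Q)).
Qed.

HB.instance Definition _ := GRing.Zmodule_isLmodule.Build Q totfrac_tensor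
  totfrac_tensor_scaleA totfrac_tensor_scale1
  totfrac_tensor_scaleDr totfrac_tensor_scaleDl.

Definition has_constant_rank (r : nat) : Prop :=
  exists f : {linear totfrac_tensor -> 'rV[Q]_r}, bijective f.

End BaseChange.

Section Conditions.
Variable R : comNzRingType.

Definition finitely_generated (M : lmodType R) : Prop :=
  exists s : seq M, forall x : M,
    exists c : 'I_(size s) -> R, x = \sum_i c i *: s`_i.

Definition zero_module (M : lmodType R) : Prop := forall x : M, x = 0.

Definition SAC_at (M : lmodType R) : Prop :=
  (forall i, (0 < i)%N -> zero_module (Ext i M R^o)) ->
  (exists n : nat, forall i, (n <= i)%N -> zero_module (Ext i M M)) ->
  forall i, (0 < i)%N -> zero_module (Ext i M M).

Definition SAC : Prop :=
  forall M : lmodType R, finitely_generated M -> SAC_at M.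

Definition SACC : Prop :=
  forall M : lmodType R, finitely_generated M ->
    (exists r, has_constant_rank M r) -> SAC_at M.

End Conditions.

(* Main.v *)
(* Let x in m be a nonzerodivisor, let F -> M be a surjection from a finite free
   module, and let E be its pullback along multiplication by x on M, so that
   0 -> E -> F (+) M -> M -> 0 is exact. The kernel and cokernel of E -> F are
   killed by x, hence E has the rank of F, even if x is a zerodivisor on M. If C
   is a free resolution of M, the mapping cocone of x : C -> C resolves E, and
   the vanishing hypotheses pass from M to E. Conversely, if Ext^i(E, E) = 0 for
   all i > 0, the exact sequence shows that x is surjective on Ext^i(E, M),
   which is zero by Nakayama's lemma; as Ext^i(E, M) contains the cokernel of x on
   Ext^i(M, M), the latter is zero by Nakayama's lemma again. *)
Require Import Defs.
From HB Require Import structures.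
From mathcomp Require Import all_boot all_algebra ring.
From mathcomp Require Import boolp classical_sets.
From mathcomp Require Import freeg.

Set Implicit Arguments.
Unset Strict Implicit.
Unset Printing Implicit Defensive.

Import GRing.Theory.
Local Open Scope ring_scope.

(** * Linear maps and projective modules *)

Definition linear_pack (R : pzRingType) (U V : lmodType R) (f : U -> V)
    (fL : linear f) : {linear U -> V} :=
  HB.pack f (GRing.isLinear.Build R U V *:%R f fL).

Section LinearMaps.
Variable R : comNzRingType.
Implicit Types U V W X Y : lmodType R.

Section Pairing.
Variables (U V W : lmodType R) (f : {linear U -> V}) (g : {linear U -> W}).

Fact pair_fun_linear : linear (fun u => (f u, g u)).
Proof. by move=> a x y; rewrite !linearP. Qed.

Definition pair_lin : {linear U -> (V * W)%type} := linear_pack pair_fun_linear.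

Lemma pair_linE u : pair_lin u = (f u, g u). Proof. by []. Qed.

End Pairing.

Definition copair_lin U V W (f : {linear U -> W}) (g : {linear V -> W}) :
    {linear (U * V)%type -> W} := (f \o fst) \+ (g \o snd).

Lemma copair_linE U V W (f : {linear U -> W}) (g : {linear V -> W}) p :
  copair_lin f g p = f p.1 + g p.2.
Proof. by []. Qed.

Lemma copair_lin_eta U V W (f : {linear (U * V)%type -> W}) p :
  f p = f (p.1, 0) + f (0, p.2).
Proof.
by case: p => a b; rewrite -linearD; congr (f (_, _)); rewrite ?addr0 ?add0r.
Qed.

Section Corestriction.
Variables (U V : lmodType R) (S : submodClosed V) (f : {linear U -> V}).
Hypothesis fS : forall u, f u \in S.

Fact corestr_fun_linear : linear (fun u => Submodule (fS u)).
Proof. by move=> a x y; apply: val_inj; rewrite /= linearP. Qed.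

Definition corestr_lin : {linear U -> submodule S} :=
  linear_pack corestr_fun_linear.

End Corestriction.

Lemma hom_eq0 U V (f : {linear U -> V}) : f = 0 -> forall u, f u = 0.
Proof. by move=> ->. Qed.

(* Lifting is asked only over the image of g, which makes the surjectivity of g
   unnecessary. *)
Definition projective U : Prop :=
  forall X Y (g : {linear X -> Y}) (f : {linear U -> Y}),
    (forall u, exists x, g x = f u) ->
    exists h : {linear U -> X}, forall u, g (h u) = f u.

Lemma projective_prod U V :
  projective U -> projective V -> projective (U * V)%type.
Proof.
move=> pU pV X Y g f fg.
have [hU hUE] := pU X Y g (f \o pair_lin idfun \0) (fun u => fg (u, 0)).
have [hV hVE] := pV X Y g (f \o pair_lin \0 idfun) (fun v => fg (0, v)).
exists (copair_lin hU hV) => p.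
by rewrite copair_linE linearD hUE hVE /= -copair_lin_eta.
Qed.

Lemma freeg_lin_ext (K : choiceType) V (f g : {linear {freeg K / R} -> V}) :
  (forall k, f << k >> = g << k >>) -> f =1 g.
Proof.
move=> fg x; rewrite -(freeg_sumE x) (linear_sum f) (linear_sum g).
apply: eq_bigr => z _.
have -> c : << c *g z >> = c *: << z >> :> {freeg K / R}.
  by apply/eqP/freeg_eqP => w; rewrite coeffZ !coeffU mul1r.
by rewrite (linearZ_LR f) (linearZ_LR g) fg.
Qed.

Lemma projective_freeg (K : choiceType) : projective {freeg K / R}.
Proof.
move=> X Y g f fg; have [c cE] := choice (fun k => fg << k >>).
exists (fglift c).
apply: (freeg_lin_ext (f := g \o fglift c)) => k.
by rewrite /= liftU scale1r cE.
Qed.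

Section RowVectors.
Variables (V : lmodType R) (n : nat) (s : 'I_n -> V).

Fact row_comb_fun_linear : linear (fun v : 'rV[R]_n => \sum_i v 0 i *: s i).
Proof.
move=> a x y; rewrite scaler_sumr -big_split; apply: eq_bigr => i _ /=.
by rewrite !mxE scalerDl scalerA.
Qed.

Definition row_comb : {linear 'rV[R]_n -> V} := linear_pack row_comb_fun_linear.

Lemma row_combE v : row_comb v = \sum_i v 0 i *: s i. Proof. by []. Qed.

End RowVectors.

Lemma row_lin_sum V n (f : {linear 'rV[R]_n -> V}) v :
  f v = \sum_i v 0 i *: f (delta_mx 0 i).
Proof.
rewrite {1}(row_sum_delta v) linear_sum; apply: eq_bigr => i _.
by rewrite linearZ.
Qed.

Lemma projective_row n : projective 'rV[R]_n.
Proof.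
move=> X Y g f fg; have [c cE] := choice (fun i => fg (delta_mx 0 i)).
exists (row_comb c) => v; rewrite row_combE linear_sum row_lin_sum.
by apply: eq_bigr => i _; rewrite linearZ_LR /= cE.
Qed.

End LinearMaps.

(* An augmented projective resolution: C 0 is the resolved module and C n.+1
   the term of homological degree n. *)
Record resolution (R : comNzRingType) := Resolution {
  res_mod :> nat -> lmodType R;
  res_d : forall n, {linear res_mod n.+1 -> res_mod n};
  res_surj : forall y, exists x, res_d 0 x = y;
  res_dd : forall n x, res_d n (res_d n.+1 x) = 0;
  res_exact : forall n x, res_d n x = 0 -> exists y, res_d n.+1 y = x;
  res_proj : forall n, projective (res_mod n.+1) }.

(** * Comparison of projective resolutions up to homotopy *)

Section Comparison.
Variable R : comNzRingType.
Implicit Types (C D : resolution R) (N : lmodType R).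

(* With the augmentation, this is Ext^n(C 0, N) = 0 for n > 0 (and void for
   n = 0). *)
Definition coh_vanish C N n : Prop :=
  forall a : {linear C n.+1 -> N}, (forall z, a (res_d C n.+1 z) = 0) ->
    exists b : {linear C n -> N}, forall z, a z = b (res_d C n z).

Lemma lift_exact C n (P : lmodType R) (f : {linear P -> C n.+1}) :
  projective P -> (forall p, res_d C n (f p) = 0) ->
  exists h : {linear P -> C n.+2}, forall p, res_d C n.+1 (h p) = f p.
Proof. by move=> pP f0; apply: pP => p; exact: res_exact. Qed.

Lemma lift_surj C (P : lmodType R) (f : {linear P -> C 0}) :
  projective P -> exists h : {linear P -> C 1}, forall p, res_d C 0 (h p) = f p.
Proof. by move=> pP; apply: pP => p; exact: res_surj. Qed.

(** The comparison theorem, two consecutive degrees at a time: [f] and [g] lift [r] and [s], and [h]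
    is a homotopy between the identity of D and the composite. Two degrees suffice to build the next
    maps, so the induction never handles a whole chain map. *)
Lemma chain_retract C D (r : {linear C 0 -> D 0}) (s : {linear D 0 -> C 0}) n :
  cancel s r ->
  exists (f : {linear C n -> D n}) (f' : {linear C n.+1 -> D n.+1})
         (g : {linear D n -> C n}) (g' : {linear D n.+1 -> C n.+1})
         (h : {linear D n -> D n.+1}) (h' : {linear D n.+1 -> D n.+2}),
  [/\ forall x, res_d D n (f' x) = f (res_d C n x),
      forall x, res_d C n (g' x) = g (res_d D n x) &
      forall x, f' (g' x) = x + res_d D n.+1 (h' x) + h (res_d D n x)].
Proof.
move=> sr; elim: n => [|n [f [f' [g [g' [h [h' [fE gE hE]]]]]]]].
  have [f' fE] := lift_surj (r \o res_d C 0) (@res_proj _ C 0).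
  have [g' gE] := lift_surj (s \o res_d D 0) (@res_proj _ D 0).
  have [|h' hE] := lift_exact (f := (f' \o g') \- idfun) (@res_proj _ D 0).
    by move=> x; rewrite /= linearB /= fE /= gE /= sr subrr.
  exists r, f', s, g', \0, h'; split=> // x.
  by rewrite hE /= addr0 addrC subrK.
have [|f2 f2E] := lift_exact (f := f' \o res_d C n.+1) (@res_proj _ C n.+1).
  by move=> x; rewrite /= fE res_dd linear0.
have [|g2 g2E] := lift_exact (f := g' \o res_d D n.+1) (@res_proj _ D n.+1).
  by move=> x; rewrite /= gE res_dd linear0.
have [|h2 h2E] := lift_exact
    (f := (f2 \o g2) \- idfun \- (h' \o res_d D n.+1)) (@res_proj _ D n.+1).
  move=> x; rewrite /= !linearB /= f2E /= g2E /= hE res_dd linear0 addr0.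
  by rewrite addrAC addrK subrr.
exists f', f2, g', g2, h', h2; split=> // x.
by rewrite h2E /= addrAC -addrA subrKC addrC subrK.
Qed.

(** If a f' = b d on C, composing with g' and using the homotopy gives a = (b g - a h) d on D,
    because the cocycle a kills d h'. *)
Lemma coh_vanish_retract C D (r : {linear C 0 -> D 0})
    (s : {linear D 0 -> C 0}) N n :
  cancel s r -> coh_vanish C N n.+1 -> coh_vanish D N n.+1.
Proof.
move=> sr vC a a0.
have [f [f' [g [g' [h [h' [fE gE hE]]]]]]] := chain_retract n.+1 sr.
have [z|b bE] := vC (a \o f').
  (* In place of a chain map in the next degree, exactness of D shows that [f'] sends boundaries to
     boundaries. *)
  have [|y yE] := @res_exact _ D n.+1 (f' (res_d C n.+2 z)).
    by rewrite fE res_dd linear0.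
  by rewrite /= -yE a0.
exists ((b \o g) \- (a \o h)) => z /=.
by rewrite -gE -bE /= hE !linearD /= a0 addr0 addrK.
Qed.

End Comparison.

(** * Ext computed from any projective resolution *)

Lemma homology_eq0 (R : comNzRingType) (U V W : lmodType R)
    (f : {linear U -> V}) (g : {linear V -> W}) :
  zero_module (homology f g) <-> forall v, g v = 0 -> exists u, f u = v.
Proof.
split=> [h0 v gv|h0 q].
  have vK : v \in lkernel g by rewrite lkernelE gv.
  have /eqP := h0 (quotmod_pi (@boundary _ _ _ _ f g) (Submodule vK)).
  by rewrite quotmod_pi_eq0 => /asboolP.
rewrite -(quotmod_piK q); apply/eqP; rewrite quotmod_pi_eq0; apply/asboolP.
by apply: h0; apply/eqP; rewrite -lkernelE (valP (repr q)).
Qed.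

Section Splice.
Variables (R : comNzRingType) (K P : nat -> lmodType R).
Variable p : forall n, {linear P n -> K n}.
Variable j : forall n, {linear K n.+1 -> P n}.
Hypothesis p_surj : forall n y, exists x, p n x = y.
Hypothesis j_inj : forall n, injective (j n).
Hypothesis pj0 : forall n y, p n (j n y) = 0.
Hypothesis pj_exact : forall n x, p n x = 0 -> exists y, j n y = x.
Hypothesis P_proj : forall n, projective (P n).

(** The short exact sequences 0 -> K (n+1) -> P n -> K n -> 0 are spliced into a resolution
    augmented onto [K 0]. *)
Definition splice_mod (n : nat) : lmodType R :=
  if n is n'.+1 then P n' else K 0.

Definition splice_d (n : nat) : {linear splice_mod n.+1 -> splice_mod n} :=
  if n is n'.+1 return {linear splice_mod n.+1 -> splice_mod n}
  then j n' \o p n'.+1 else p 0.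

Lemma splice_dd n x : splice_d n (splice_d n.+1 x) = 0.
Proof. by case: n x => [|n] x /=; rewrite pj0 ?linear0. Qed.

Lemma splice_exact n x : splice_d n x = 0 -> exists y, splice_d n.+1 y = x.
Proof.
move=> dx; have [|y <-] := @pj_exact n x.
  by case: n x dx => [|n] x //= dx; apply: (@j_inj n); rewrite dx linear0.
by have [z <-] := p_surj y; exists z.
Qed.

Definition splice_resolution : resolution R :=
  @Resolution R splice_mod splice_d (p_surj (n := 0)) splice_dd splice_exact
    P_proj.

End Splice.

Section KernelInclusion.
Variables (R : comNzRingType) (U V : lmodType R) (f : {linear U -> V}).

Definition lkernel_val : {linear submodule (lkernel f) -> U} := val.

Lemma lkernel_val_inj : injective lkernel_val. Proof. exact: val_inj. Qed.

Lemma lkernel_val0 y : f (lkernel_val y) = 0.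
Proof. exact/eqP/(valP y). Qed.

Lemma lkernel_val_exact x : f x = 0 -> exists y, lkernel_val y = x.
Proof. by move/eqP=> fx; exists (Submodule (fx : x \in lkernel f)). Qed.

End KernelInclusion.

Section StandardResolution.
Variables (R : comNzRingType) (M : lmodType R).

Definition std_resolution : resolution R :=
  @splice_resolution R (syzygy M) (free_res M)
    (fun n => free_cover (syzygy M n))
    (fun n => lkernel_val (free_cover (syzygy M n)))
    (fun n y => ex_intro _ << y >> (free_cover_gen y))
    (fun n => @lkernel_val_inj _ _ _ _)
    (fun n => @lkernel_val0 _ _ _ _)
    (fun n => @lkernel_val_exact _ _ _ _)
    (fun n => @projective_freeg R _).


Lemma Ext_d_eq0 (N : lmodType R) n (a : {linear free_res M n -> N}) :
  Ext_d M N n a = 0 <-> forall z, a (free_res_d M n z) = 0.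
Proof.
split=> [a0 z|a0]; last by apply: linear_ext => z; exact: a0.
exact: (hom_eq0 a0 z).
Qed.

Lemma std_resolution_d n : res_d std_resolution n.+1 = free_res_d M n.
Proof. by []. Qed.

(** The augmentation shifts indices by one: [free_res M n] is term [n.+1] of the resolution, so
    cocycles for [Ext n.+1] live on its term [n.+2]. *)
Lemma Ext_eq0 (N : lmodType R) n :
  zero_module (Ext n.+1 M N) <-> coh_vanish std_resolution N n.+1.
Proof.
split=> [/homology_eq0 vE a a0|vE].
  have [|b bE] := vE (a : {linear free_res M n.+1 -> N}).
    by apply/Ext_d_eq0 => z; rewrite -std_resolution_d; exact: a0.
  exists b => z.
  by rewrite -[LHS]/((a : {linear free_res M n.+1 -> N}) z) -bE.
apply/homology_eq0 => a /Ext_d_eq0 a0.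
have [z|b bE] := vE a; first by rewrite std_resolution_d; exact: a0.
by exists b; apply: linear_ext => z; rewrite bE std_resolution_d.
Qed.

End StandardResolution.

(** C and the standard resolution of [C 0] resolve the same module, so the retraction lemma applies
    to the identity in both directions. *)
Lemma Ext_coh_vanish (R : comNzRingType) (C : resolution R) (N : lmodType R) n :
  zero_module (Ext n.+1 (C 0) N) <-> coh_vanish C N n.+1.
Proof.
have idK : cancel (idfun : {linear C 0 -> C 0}) idfun by [].
rewrite Ext_eq0; split.
  exact: (coh_vanish_retract (C := std_resolution (C 0)) idK).
exact: (coh_vanish_retract (D := std_resolution (C 0)) idK).
Qed.

(** * Noetherian modules *)

Section NoetherianModules.
Variable R : comNzRingType.
Implicit Types U V W M : lmodType R.

(** Stated on sets in the shape of [is_ideal], so that over [R^o] the hypothesis [noetherian R]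
    applies by conversion. *)
Definition is_submodule V (S : set V) : Prop :=
  S 0 /\ forall a x y, S x -> S y -> S (a *: x + y).

Definition gen_by V (s : seq V) : set V :=
  [set x | exists c : 'I_(size s) -> R, x = \sum_i c i *: s`_i].

Lemma is_submoduleZ V (S : set V) a x : is_submodule S -> S x -> S (a *: x).
Proof. by case=> S0 SD Sx; rewrite -[_ *: _]addr0; exact: SD. Qed.

Lemma is_submoduleD V (S : set V) x y :
  is_submodule S -> S x -> S y -> S (x + y).
Proof. by case=> _ SD Sx Sy; rewrite -[x]scale1r; exact: SD. Qed.

Lemma is_submoduleB V (S : set V) x y :
  is_submodule S -> S x -> S y -> S (x - y).
Proof. by case=> _ SD Sx Sy; rewrite addrC -scaleN1r; exact: SD. Qed.

Lemma is_submodule_preim U V (f : {linear U -> V}) (S : set V) :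
  is_submodule S -> is_submodule (f @^-1` S)%classic.
Proof.
case=> S0 SD; split=> [|a x y]; rewrite /preimage /= ?linear0 //.
by rewrite linearP; exact: SD.
Qed.

Lemma is_submodule_image U V (f : {linear U -> V}) (S : set U) :
  is_submodule S -> is_submodule (f @` S)%classic.
Proof.
case=> S0 SD; split=> [|a _ _ [x Sx <-] [y Sy <-]].
  by exists 0; rewrite ?linear0.
by exists (a *: x + y); rewrite ?linearP //; exact: SD.
Qed.

Lemma gen_by_submodule V (s : seq V) : is_submodule (gen_by s).
Proof.
split=> [|a _ _ [c ->] [c' ->]].
  by exists (fun=> 0); rewrite big1 // => i _; rewrite scale0r.
exists (fun i => a * c i + c' i); rewrite scaler_sumr -big_split.
by apply: eq_bigr => i _; rewrite /= scalerDl scalerA.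
Qed.

Lemma mem_gen_by V (s : seq V) x : x \in s -> gen_by s x.
Proof.
move=> xs; have xi : (index x s < size s)%N by rewrite index_mem.
exists (fun i => (i == Ordinal xi)%:R); rewrite (bigD1 (Ordinal xi)) //=.
rewrite eqxx scale1r nth_index // big1 ?addr0 // => i /negPf ->.
by rewrite scale0r.
Qed.

Lemma gen_by_min V (s : seq V) (S : set V) :
  is_submodule S -> (forall x, x \in s -> S x) -> forall x, gen_by s x -> S x.
Proof.
move=> SM sS _ [c ->]; elim/big_ind: _ => [|x y|i _].
- by case: SM.
- exact: is_submoduleD.
- by apply: is_submoduleZ => //; apply/sS/mem_nth.
Qed.

Definition noetherian_module V : Prop :=
  forall S : set V, is_submodule S -> exists s, S = gen_by s.

Lemma noetherian_module_fg V : noetherian_module V -> finitely_generated V.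
Proof.
move=> nV; have [|s sE] := nV (fun=> True); first by [].
by exists s => x; have : gen_by s x by rewrite -sE.
Qed.

(** A submodule S is generated by the images of generators of its preimage under j together with
    lifts to S of generators of g(S). *)
Lemma noetherian_module_ext U V W (j : {linear U -> V}) (g : {linear V -> W}) :
  (forall v, g v = 0 -> exists u, j u = v) ->
  noetherian_module U -> noetherian_module W -> noetherian_module V.
Proof.
move=> jg nU nW S SM.
have [s sE] := nU _ (is_submodule_preim j SM).
have [t tE] := nW _ (is_submodule_image g SM).
(* The implication sits under the existential so that [choice] yields a total function; outside g(S)
   its value is the default 0. *)
have lift w : exists v, (g @` S)%classic w -> S v /\ g v = w.
  by case: (pselect ((g @` S)%classic w)) => [[v Sv <-]|nw];
    [exists v | exists 0 => /nw].
have [l lE] := choice lift.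
exists (map j s ++ map l t); apply/seteqP; split=> [v Sv|].
  (* Some v' in both G and S has the same image as v under g; then v - v' comes from the preimage of
     S under j, hence lies in G. *)
  set G := gen_by _; have GM : is_submodule G by exact: gen_by_submodule.
  have [v' Gv' gv'] : (g @` G)%classic (g v).
    apply: (gen_by_min (s := t)); first exact: is_submodule_image.
      move=> w wt; have [_ <-] : S (l w) /\ g (l w) = w.
        by apply: lE; rewrite tE; exact: mem_gen_by.
      exists (l w) => //; apply: mem_gen_by.
      by rewrite mem_cat map_f ?orbT.
    by rewrite -tE; exists v.
  have Sv' : S v'.
    move: v' Gv' {gv'}; apply: gen_by_min => // x; rewrite mem_cat.
    case/orP=> /mapP[y yI ->].
      by have : (j @^-1` S)%classic y by rewrite sE; exact: mem_gen_by.
    by apply: (proj1 (lE _ _)); rewrite tE; exact: mem_gen_by.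
  have [u uE] : exists u, j u = v - v' by apply: jg; rewrite linearB gv' subrr.
  rewrite -(subrK v' v) -uE; apply: is_submoduleD => //.
  have : gen_by s u by rewrite -sE /preimage /= uE; exact: is_submoduleB.
  apply: (gen_by_min (S := (j @^-1` G)%classic)).
    exact: is_submodule_preim.
  by move=> y ys; apply: mem_gen_by; rewrite mem_cat map_f.
apply: gen_by_min => // x; rewrite mem_cat => /orP[] /mapP[y yI ->].
  by have : (j @^-1` S)%classic y by rewrite sE; exact: mem_gen_by.
by apply: (proj1 (lE _ _)); rewrite tE; exact: mem_gen_by.
Qed.

Lemma noetherian_module_inj V W (g : {linear V -> W}) :
  injective g -> noetherian_module W -> noetherian_module V.
Proof.
(* The zero map has the kernel of g as its image; W serves as its source because it is already known
   to be Noetherian. *)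
move=> gI nW; pose j : {linear W -> V} := \0.
apply: (noetherian_module_ext (j := j) (g := g)) => //.
by move=> v gv; exists 0; apply: gI; rewrite gv [LHS]linear0.
Qed.

Lemma noetherian_module_surj V W (g : {linear V -> W}) :
  (forall y, exists x, g x = y) -> noetherian_module V -> noetherian_module W.
Proof.
move=> gS nV S SM; have [s sE] := nV _ (is_submodule_preim g SM).
exists (map g s); apply/seteqP; split=> [y|].
  have [x <-] := gS y => Sgx; have : gen_by s x by rewrite -sE.
  apply: (gen_by_min (S := (g @^-1` gen_by (map g s))%classic)).
    exact/is_submodule_preim/gen_by_submodule.
  by move=> z zs; apply: mem_gen_by; rewrite map_f.
apply: gen_by_min => // _ /mapP[x xs ->].
by have : (g @^-1` S)%classic x by rewrite sE; exact: mem_gen_by.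
Qed.

Lemma noetherian_module_prod V W :
  noetherian_module V -> noetherian_module W ->
  noetherian_module (V * W)%type.
Proof.
apply: (noetherian_module_ext (j := pair_lin idfun \0) (g := snd)).
by move=> [v w] /= ->; exists v.
Qed.

Section Evaluation.
Variables (V W : lmodType R) (n : nat) (f : 'I_n -> {linear V -> W}).

Fact ffun_fun_linear : linear (fun v => [ffun i => f i v]).
Proof. by move=> a x y; apply/ffunP => i; rewrite !ffunE linearP. Qed.

Definition ffun_lin : {linear V -> {ffun 'I_n -> W}} :=
  linear_pack ffun_fun_linear.

Lemma ffun_linE v i : ffun_lin v i = f i v. Proof. exact: ffunE. Qed.

End Evaluation.

Fact ffun_eval_linear V n (i : 'I_n) : linear (fun f : {ffun 'I_n -> V} => f i).
Proof. by move=> a f g; rewrite !ffunE. Qed.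

Definition ffun_eval V n (i : 'I_n) : {linear {ffun 'I_n -> V} -> V} :=
  linear_pack (@ffun_eval_linear V n i).

Lemma noetherian_module_ffun V n :
  noetherian_module V -> noetherian_module {ffun 'I_n -> V}.
Proof.
move=> nV; elim: n => [|n IHn].
  by apply: (noetherian_module_inj (g := (\0 : {linear _ -> V}))) => // f g _;
    apply/ffunP; case.
pose g : {linear {ffun 'I_n.+1 -> V} -> (V * {ffun 'I_n -> V})%type} :=
  pair_lin (ffun_eval V ord0)
    (ffun_lin (fun i => ffun_eval V (fintype.lift ord0 i))).
apply: (noetherian_module_inj (g := g)); last exact: noetherian_module_prod.
move=> f f'; rewrite !pair_linE => -[f0 /ffunP fS]; apply/ffunP => i.
by case: (unliftP ord0 i) => [k|] -> //; have := fS k; rewrite !ffunE.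
Qed.

(** A linear map is determined by its values on n generators of U, which embeds Hom(U, V) into
    V^n. *)
Lemma noetherian_module_hom U V :
  finitely_generated U -> noetherian_module V ->
  noetherian_module {linear U -> V}.
Proof.
move=> [s sU] nV.
have evL (u : U) : linear (fun f : {linear U -> V} => f u) by [].
apply: (noetherian_module_inj
  (g := ffun_lin (fun i : 'I_(size s) => linear_pack (evL s`_i)))); last first.
  exact: noetherian_module_ffun.
move=> f g /ffunP fg; apply: linear_ext => x; have [c ->] := sU x.
rewrite !linear_sum; apply: eq_bigr => i _; rewrite !linearZ /=.
by have := fg i; rewrite !ffun_linE /= => ->.
Qed.

Hypothesis noethR : noetherian R.

Lemma noetherian_module_row n : noetherian_module 'rV[R]_n.
Proof.
have coordL (i : 'I_n) : linear (fun v : 'rV[R]_n => v 0 i : R^o).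
  by move=> a x y; rewrite !mxE.
pose g := ffun_lin (fun i => linear_pack (coordL i)).
apply: (noetherian_module_inj (g := g)).
  by move=> u v /ffunP uv; apply/rowP => i; have := uv i; rewrite !ffun_linE.
by apply: noetherian_module_ffun => S; exact: noethR.
Qed.

Lemma fg_noetherian_module V : finitely_generated V -> noetherian_module V.
Proof.
move=> [s sV]; apply: (noetherian_module_surj
  (g := row_comb (fun i : 'I_(size s) => s`_i)) _ (@noetherian_module_row _)).
move=> x; have [c ->] := sV x; exists (\row_i c i).
by rewrite row_combE; apply: eq_bigr => i _; rewrite mxE.
Qed.

End NoetherianModules.

(** * Resolutions by free modules of finite rank *)

Section FinitelyGeneratedResolution.
Variable R : comNzRingType.
Implicit Types M : lmodType R.

(** The default [[::]] makes covers and syzygies total in M; they are surjective covers once M is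
    finitely generated. *)
Definition generators M : seq M :=
  xget [::] [set s : seq M | forall x, gen_by s x].

Definition fg_cover M : {linear 'rV[R]_(size (generators M)) -> M} :=
  row_comb (fun i => (generators M)`_i).

Lemma fg_cover_surj M :
  finitely_generated M -> forall x, exists v, fg_cover M v = x.
Proof.
move=> [s sM] x; have [c ->] : gen_by (generators M) x.
  by move: x; rewrite /generators; case: xgetP => [_ -> //|/(_ s)/(_ sM)].
exists (\row_i c i); rewrite /fg_cover row_combE.
by apply: eq_bigr => i _; rewrite mxE.
Qed.

Fixpoint fg_syzygy M (n : nat) : lmodType R :=
  if n is n'.+1 then submodule (lkernel (fg_cover (fg_syzygy M n'))) else M.

Hypothesis noethR : noetherian R.

Lemma fg_syzygy_fg M n :
  finitely_generated M -> finitely_generated (fg_syzygy M n).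
Proof.
move=> fgM; case: n => //= n; apply: noetherian_module_fg.
apply: (noetherian_module_inj (@lkernel_val_inj _ _ _ _)).
exact: noetherian_module_row.
Qed.

Lemma fg_resolution_surj M : finitely_generated M ->
  forall n y, exists x, fg_cover (fg_syzygy M n) x = y.
Proof. by move=> fgM n; exact/fg_cover_surj/fg_syzygy_fg. Qed.

(** Its terms are finitely generated, as Nakayama's lemma on cochains requires, and its first free
    term will give the rank of the pullback. *)
Definition fg_resolution M (fgM : finitely_generated M) : resolution R :=
  @splice_resolution R (fg_syzygy M)
    (fun n => 'rV[R]_(size (generators (fg_syzygy M n))))
    (fun n => fg_cover (fg_syzygy M n))
    (fun n => lkernel_val (fg_cover (fg_syzygy M n)))
    (fg_resolution_surj fgM)
    (fun n => @lkernel_val_inj _ _ _ _)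
    (fun n => @lkernel_val0 _ _ _ _)
    (fun n => @lkernel_val_exact _ _ _ _)
    (fun n => @projective_row R _).

End FinitelyGeneratedResolution.

(** * Maximal ideals, units and Nakayama's lemma *)

Section LocalRings.
Variables (R : comNzRingType) (m : set R).

(** Krull's theorem: Zorn's lemma on the proper ideals that contain I. *)
Lemma exists_maximal_ideal (I : set R) : is_ideal I -> ~ I 1 ->
  exists m', maximal_ideal m' /\ (I `<=` m')%classic.
Proof.
move=> II I1.
pose good J := [/\ is_ideal J, (I `<=` J)%classic & ~ J 1].
(* The empty set is added so that the empty chain has a union. *)
have [|A [[A0|[AI IA A1]] Amax]] :=
  @Zorn_bigcup R (fun J => J = set0 \/ good J).
- move=> F Fgood Ftot.
  have [F0|[J [FJ gJ]]] :
      (forall J, F J -> J = set0) \/ exists J, F J /\ good J.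
    case: (pselect (exists J, F J /\ good J)) => [|nF]; [by right | left].
    move=> J FJ; case: (Fgood J FJ) => // gJ; case: nF; by exists J.
  + by left; apply/seteqP; split=> // x [J FJ]; rewrite (F0 _ FJ).
  + have gF K x : F K -> K x -> good K.
      by move=> FK Kx; case: (Fgood K FK) => // K0; move: Kx; rewrite K0.
    right; split.
    * split=> [|a x y [K FK Kx] [L FL Ly]].
        by exists J => //; case: gJ => -[].
      have [KL|LK] := Ftot _ _ FK FL.
        exists L => //; have [[_ LD] _ _] := gF _ _ FL Ly.
        by apply: LD => //; exact: KL.
      exists K => //; have [[_ KD] _ _] := gF _ _ FK Kx.
      by apply: KD => //; exact: LK.
    * by move=> x Ix; exists J => //; case: gJ => _ IJ _; exact: IJ.
    * by move=> [K FK K1]; have [_ _] := gF _ _ FK K1.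
- exfalso; apply: (Amax I); last by right; split.
  by rewrite A0 properEneq; split=> //; apply/eqP => I0; case: II; rewrite -I0.
- exists A; split=> //; split=> // J JI AJ J1.
  apply: contrapT => JA; apply: (Amax J); first by
    rewrite properEneq; split=> //; apply/eqP => /esym.
  by right; split=> //; exact: subset_trans AJ.
Qed.

Hypothesis locR : local_ring m.

(** Were the ideal (1 + x) proper, it would lie in m, and then so would 1 = (1 + x) - x. *)
Lemma local_unit x : m x -> exists u, u * (1 + x) = 1.
Proof.
case: locR => -[[m0 mD] m1 _] m_uniq mx.
pose I : set R := [set a | exists u, u * (1 + x) = a]%classic.
have II : is_ideal I.
  split; first by exists 0; rewrite mul0r.
  by move=> a _ _ [u <-] [v <-]; exists (a * u + v); rewrite mulrDl mulrA.
apply: contrapT => /(exists_maximal_ideal II)[m' [/m_uniq -> Im]].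
apply: m1; have -> : 1 = (- 1) * x + (1 + x) by ring.
by apply: mD => //; apply: Im; exists 1; rewrite mul1r.
Qed.

(** Generators are eliminated one by one. Modulo a, the induction hypothesis puts s into B' = B +
    Ra. Then a = x z' and z' = - c a modulo B, so (1 + x c) a lies in B, and 1 + x c is a unit. *)
Lemma nakayama_gen (x : R) (V : lmodType R) (s : seq V) (B : set V) :
  m x -> is_submodule B ->
  (forall z, z \in s -> exists z', gen_by s z' /\ B (z - x *: z')) ->
  forall z, z \in s -> B z.
Proof.
move=> mx; elim: s B => // a s IHs B BM sB.
pose B' : set V := [set v | exists c, B (v + c *: a)]%classic.
have BB' v : B v -> B' v by exists 0; rewrite scale0r addr0.
have B'M : is_submodule B'.
  split=> [|b v w [c Bv] [c' Bw]]; first by apply: BB'; case: BM.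
  exists (b * c + c'); case: BM => _ /(_ b _ _ Bv Bw).
  by rewrite scalerDl scalerDr addrACA scalerA.
have B'a : B' a by exists (-1); rewrite scaleN1r subrr; case: BM.
have split_gen v : gen_by (a :: s) v ->
    exists c w, gen_by s w /\ v = c *: a + w.
  pose S : set V := [set v | exists c w, gen_by s w /\ v = c *: a + w]%classic.
  have [s0 sD] := gen_by_submodule s.
  apply: (gen_by_min (S := S)).
    split; first by exists 0, 0; rewrite scale0r addr0.
    move=> b _ _ [c [w [sw ->]]] [c' [w' [sw' ->]]].
    exists (b * c + c'), (b *: w + w'); split; first exact: sD.
    by rewrite scalerDl scalerDr addrACA scalerA.
  move=> w; rewrite inE => /orP[/eqP ->|ws].
    by exists 1, 0; rewrite scale1r addr0.
  by exists 0, w; rewrite scale0r add0r; split=> //; exact: mem_gen_by.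
have B's z : z \in s -> B' z.
  (* With z' = c a + w, the element z - x w differs from z - x z' by a multiple of a, so w replaces
     z' modulo B'. *)
  move: z; apply: IHs => // z zs.
  have [|_ [/split_gen[c [w [sw ->]]] Bz]] := sB z.
    by rewrite inE zs orbT.
  exists w; split=> //; exists (- (x * c)).
  by move: Bz; rewrite scalerDr opprD addrA addrAC scalerA scaleNr.
have Ba : B a.
  have [|z' [sz' Bz]] := sB a; first exact: mem_head.
  have [c Bc] : B' z'.
    move: z' sz' {Bz}; apply: gen_by_min => // w.
    by rewrite inE => /orP[/eqP ->|]; [|exact: B's].
  have [|u uE] := @local_unit (x * c).
    by case: locR => -[[m0 mD] _ _] _; rewrite mulrC -[_ * _]addr0; exact: mD.
  rewrite -[a]scale1r -uE -scalerA; apply: is_submoduleZ => //.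
  case: BM => _ /(_ x _ _ Bc Bz); rewrite scalerDr scalerDl scale1r scalerA.
  by rewrite addrC addrA subrK.
move=> z; rewrite inE => /orP[/eqP -> //|/B's[c Bc]].
rewrite -(addrK (c *: a) z).
by apply: is_submoduleB => //; exact: is_submoduleZ.
Qed.

(** Noetherianity of V supplies the finite list of generators of Z consumed by [nakayama_gen]. *)
Lemma nakayama (x : R) (V : lmodType R) (Z B : set V) :
  noetherian_module V -> m x -> is_submodule Z -> is_submodule B ->
  (forall z, Z z -> exists z', Z z' /\ B (z - x *: z')) ->
  forall z, Z z -> B z.
Proof.
move=> nV mx ZM BM ZB; have [s sE] := nV Z ZM; rewrite sE.
apply: gen_by_min => //; apply: (nakayama_gen (x := x)) => // z zs.
by rewrite -sE; apply: ZB; rewrite sE; exact: mem_gen_by.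
Qed.

End LocalRings.

(** * The pullback along multiplication by x and its resolution *)

Section Cocone.
Variables (R : comNzRingType) (x : R) (C : resolution R).

Definition pullback_eq : {linear (C 1 * C 0)%type -> C 0} :=
  copair_lin (res_d C 0) (- x \*: idfun).

Definition pullback : lmodType R := submodule (lkernel pullback_eq).

Lemma pullbackP p :
  reflect (res_d C 0 p.1 = x *: p.2) (p \in lkernel pullback_eq).
Proof.
rewrite lkernelE /pullback_eq copair_linE /= scaleNr subr_eq0.
exact: eqP.
Qed.

Lemma pullback_valP (e : pullback) : res_d C 0 (val e).1 = x *: (val e).2.
Proof. exact/pullbackP/(valP e). Qed.

Definition cocone_shift n : {linear (C n.+1 * C n.+2)%type -> C n.+1} :=
  copair_lin (x \*: idfun) (res_d C n.+1).

Definition cocone_aug0 : {linear (C 1 * C 2)%type -> (C 1 * C 0)%type} :=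
  pair_lin (cocone_shift 0) (res_d C 0 \o fst).

Fact cocone_aug0P p : cocone_aug0 p \in lkernel pullback_eq.
Proof.
by apply/pullbackP; rewrite /= linearD linearZ_LR res_dd addr0.
Qed.

Definition cocone_aug : {linear (C 1 * C 2)%type -> pullback} :=
  corestr_lin cocone_aug0P.

Lemma val_cocone_aug p :
  val (cocone_aug p) = (x *: p.1 + res_d C 1 p.2, res_d C 0 p.1).
Proof. by []. Qed.

(** The pullback is an extension of [C 0] by its first syzygy, hence the sums of consecutive terms.
    The term [C 1] that the full mapping cocone has in degree -1 is left out. *)
Definition cocone_mod (n : nat) : lmodType R :=
  if n is n'.+1 then (C n'.+1 * C n'.+2)%type : lmodType R else pullback.

(** The minus sign makes the two terms in x cancel in the square of the differential. *)
Definition cocone_dS n :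
    {linear (C n.+2 * C n.+3)%type -> (C n.+1 * C n.+2)%type} :=
  pair_lin (res_d C n.+1 \o fst) (\- cocone_shift n.+1).

Definition cocone_d n : {linear cocone_mod n.+1 -> cocone_mod n} :=
  if n is n'.+1 return {linear cocone_mod n.+1 -> cocone_mod n}
  then cocone_dS n' else cocone_aug.

Lemma cocone_dSE n p : cocone_dS n p =
  (res_d C n.+1 p.1, - (x *: p.1 + res_d C n.+2 p.2)).
Proof. by []. Qed.

Lemma cocone_surj y : exists p, cocone_aug p = y.
Proof.
have [a aE] := res_surj (val y).2.
have [|b bE] := @res_exact _ C 0 ((val y).1 - x *: a).
  by rewrite linearB linearZ_LR aE pullback_valP subrr.
exists (a, b); apply: val_inj; rewrite val_cocone_aug /= bE aE subrKC.
exact/esym/surjective_pairing.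
Qed.

Lemma cocone_dd n p : cocone_d n (cocone_d n.+1 p) = 0.
Proof.
case: n p => [|n] p.
  apply: val_inj; rewrite [LHS]val_cocone_aug [cocone_d 1 p]cocone_dSE /=.
  rewrite linearN linearD linearZ_LR !res_dd addr0 subrr.
  exact/esym/(linear0 (lkernel_val pullback_eq)).
rewrite [LHS]cocone_dSE [cocone_d n.+2 p]cocone_dSE /= (linearN (res_d _ _)).
by rewrite (linearD (res_d _ _)) linearZ_LR !res_dd addr0 subrr oppr0.
Qed.

(** Up to sign the same two equations cut out the kernels of the augmentation and of the higher
    differentials. If p = (d a', b), then x a' + b is a cycle d c, and (a', - c) maps to p. *)
Lemma cocone_exact_aux n (p : C n.+1 * C n.+2) :
  res_d C n p.1 = 0 -> x *: p.1 + res_d C n.+1 p.2 = 0 ->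
  exists q, cocone_dS n q = p.
Proof.
case: p => a b /= /res_exact[a' <-]; rewrite -linearZ_LR -linearD.
move=> /res_exact[c cE]; exists (a', - c).
by rewrite /= (linearN (res_d _ _)) cE opprD opprK addrA addNr add0r.
Qed.

Lemma cocone_exact n p : cocone_d n p = 0 -> exists q, cocone_d n.+1 q = p.
Proof.
case: n p => [|n] p dp; apply: cocone_exact_aux.
- by have := congr1 (fun e : pullback => (val e).2) dp.
- by have := congr1 (fun e : pullback => (val e).1) dp.
- by have := congr1 fst dp.
- have := congr1 snd dp; rewrite [cocone_d n.+1 p]cocone_dSE /=.
  by move/eqP; rewrite oppr_eq0 => /eqP.
Qed.

Lemma cocone_proj n : projective (cocone_mod n.+1).
Proof. by apply: projective_prod; exact: res_proj. Qed.

(* The mapping cocone of multiplication by x on C, which resolves the pullback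
   of the augmentation along multiplication by x. *)
Definition cocone : resolution R :=
  @Resolution R cocone_mod cocone_d cocone_surj cocone_dd cocone_exact
    cocone_proj.

(** A cocycle is a pair (a, b) with b d = 0 and a d = x b. Vanishing in the upper degree gives b =
    b' d; then a - x b' is a cocycle, and vanishing in the lower degree makes it a coboundary. *)
Lemma cocone_coh_vanish N n :
  coh_vanish C N n.+1 -> coh_vanish C N n.+2 -> coh_vanish cocone N n.+1.
Proof.
move=> v1 v2 c c0.
have [a [b cE]] : exists (a : {linear C n.+2 -> N}) (b : {linear C n.+3 -> N}),
    forall p, c p = a p.1 + b p.2.
  exists (c \o pair_lin idfun \0), (c \o pair_lin \0 idfun).
  exact: copair_lin_eta.
have abE p : a (res_d C n.+2 p.1) = b (x *: p.1 + res_d C n.+3 p.2).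
  have := c0 p; rewrite cE [res_d cocone n.+2 p]cocone_dSE /= linearN.
  by move/eqP; rewrite subr_eq0 => /eqP.
have [z|b' b'E] := v2 b.
  by have := abE (0, z); rewrite /= scaler0 add0r => <-; rewrite !linear0.
have [z|a' a'E] := v1 (a \- (x \*: b')).
  have := abE (z, 0); rewrite /= linear0 addr0 => ->.
  by rewrite linearZ_LR b'E /= -linearZ_LR subrr.
exists (copair_lin a' (\- b')) => p.
rewrite cE b'E copair_linE [res_d cocone n.+1 p]cocone_dSE /= -a'E /=.
rewrite (linearN b') opprK (linearD b') (linearZ_LR b') addrA.
by rewrite subrK.
Qed.

End Cocone.

(** * Transfer of Ext vanishing between the pullback and the resolved module *)

Section Descent.
Variable R : comNzRingType.
Implicit Types (C D : resolution R) (M N : lmodType R).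

Definition cocycle D N n (a : {linear D n.+1 -> N}) : Prop :=
  forall z, a (res_d D n.+1 z) = 0.

Fact row_fun_linear (V : lmodType R) k (b : 'I_k -> {linear V -> R^o}) :
  linear (fun v => \row_i b i v : 'rV[R]_k).
Proof. by move=> r u v; apply/rowP => i; rewrite !mxE linearP. Qed.

Lemma coh_vanish_row D k n : coh_vanish D R^o n -> coh_vanish D 'rV[R]_k n.
Proof.
move=> vD a a0.
have coordL (i : 'I_k) : linear (fun z => a z 0 i : R^o).
  by move=> r u v; rewrite linearP !mxE.
have bE i : exists b : {linear D n -> R^o}, forall z, a z 0 i = b (res_d D n z).
  by apply: (vD (linear_pack (coordL i))) => z /=; rewrite a0 mxE.
have [b {}bE] := choice bE.
exists (linear_pack (row_fun_linear b)) => z.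
by apply/rowP => i; rewrite mxE bE.
Qed.

(* H^n(Hom(D, N)) = x H^n(Hom(D, N)) *)
Definition coh_divisible (x : R) D N n : Prop :=
  forall a : {linear D n.+1 -> N}, cocycle a ->
    exists (b : {linear D n.+1 -> N}) (c : {linear D n -> N}),
      cocycle b /\ forall z, a z = x *: b z + c (res_d D n z).

(** Nakayama's lemma in the Noetherian module Hom(D (n+1), N), for the cocycles Z and the
    coboundaries B. *)
Lemma coh_divisible_vanish (m : set R) (x : R) D N n :
  local_ring m -> m x -> finitely_generated (D n.+1) -> noetherian_module N ->
  coh_divisible x D N n -> coh_vanish D N n.
Proof.
move=> locR mx fgD nN xD.
pose V : lmodType R := {linear D n.+1 -> N}.
pose Z : set V := [set a | cocycle (a : {linear D n.+1 -> N})]%classic.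
pose B : set V := [set a | exists b : {linear D n -> N},
  forall z, (a : {linear D n.+1 -> N}) z = b (res_d D n z)]%classic.
suff ZB a : Z a -> B a by move=> a /ZB.
move: a; apply: (nakayama locR (x := x)) => //.
- exact: noetherian_module_hom.
- split=> [z //|r a b Za Zb z].
  by rewrite /= /hom_add /= /hom_scale /= Za Zb scaler0 addr0.
- split=> [|r a b [a' a'E] [b' b'E]]; first by exists \0.
  by exists ((r \*: a') \+ b') => z; rewrite /= -a'E -b'E.
- move=> a /xD[b [c [Zb abc]]]; exists b; split=> //.
  by exists c => z; rewrite /= abc /= addrC addKr.
Qed.

Variables (x : R) (C : resolution R).
Local Notation E := (pullback x C).

Definition pullback_fst : {linear E -> C 1} := fst \o lkernel_val _.
Definition pullback_snd : {linear E -> C 0} := snd \o lkernel_val _.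

Lemma pullback_val (e : E) : res_d C 0 (pullback_fst e) = x *: pullback_snd e.
Proof. exact: pullback_valP. Qed.

Lemma pullback_inj (e e' : E) :
  pullback_fst e = pullback_fst e' -> pullback_snd e = pullback_snd e' ->
  e = e'.
Proof.
move=> e1 e2; apply: val_inj.
by rewrite [LHS]surjective_pairing [RHS]surjective_pairing; congr (_, _).
Qed.

Lemma pullback_pair (V : lmodType R) (f : {linear V -> C 1})
    (g : {linear V -> C 0}) :
  (forall v, res_d C 0 (f v) = x *: g v) ->
  exists h : {linear V -> E}, forall v,
    pullback_fst (h v) = f v /\ pullback_snd (h v) = g v.
Proof.
move=> fg; have fgP v : pair_lin f g v \in lkernel (pullback_eq x C).
  exact/pullbackP/fg.
by exists (corestr_lin fgP).
Qed.

(** The long exact sequence of 0 -> E -> C 1 (+) C 0 -> C 0 -> 0, chased by hand. *)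
Lemma coh_vanish_pullback D n :
  coh_vanish D (C 0) n.+1 -> coh_vanish D (C 1) n.+2 ->
  coh_vanish D (C 0) n.+2 -> coh_vanish D E n.+2.
Proof.
move=> v0 v1 v2 c c0.
have [z|c1 c1E] := v1 (pullback_fst \o c); first by rewrite /= c0 linear0.
have [z|c2 c2E] := v2 (pullback_snd \o c); first by rewrite /= c0 linear0.
(* The primitives c1, c2 need not define a map into E; their defect d c1 - x c2 is a cocycle one
   degree lower. Lifting its primitive e to [C 1] corrects c1. *)
have [z|e eE] := v0 ((res_d C 0 \o c1) \- (x \*: c2)).
  by rewrite /= -c1E -c2E /= pullback_val subrr.
have [e' e'E] := lift_surj e (@res_proj _ D n).
have [v|h hE] := pullback_pair (f := c1 \- (e' \o res_d D n.+1)) (g := c2).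
  by rewrite /= linearB /= e'E -eE /= opprB addrC subrK.
exists h => z; have [h1 h2] := hE (res_d D n.+2 z).
apply: pullback_inj; first by rewrite h1 /= res_dd linear0 subr0 -c1E.
by rewrite h2 -c2E.
Qed.

(** In the same long exact sequence, the vanishing for E makes Ext(D, C 1 (+) C 0) surject onto
    Ext(D, C 0), and the vanishing for [C 1] leaves only multiplication by x. *)
Lemma coh_divisible_pullback D n :
  coh_vanish D E n.+2 -> coh_vanish D (C 1) n.+1 ->
  coh_divisible x D (C 0) n.+1.
Proof.
move=> vE v1 a a0.
have [a' a'E] := lift_surj a (@res_proj _ D n.+1).
(* The map (a' d, 0) represents the image of a under the connecting homomorphism. *)
have [v|e eE] := pullback_pair (f := a' \o res_d D n.+2) (g := \0).
  by rewrite /= a'E a0 scaler0.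
have [z|h hE] := vE e.
  apply: pullback_inj; rewrite ?(proj1 (eE _)) ?(proj2 (eE _)) ?linear0 //=.
  by rewrite res_dd linear0.
have [z|c cE] := v1 (a' \- (pullback_fst \o h)).
  by rewrite -[LHS]/(a' _ - pullback_fst (h _)) -hE (proj1 (eE _)) subrr.
exists (pullback_snd \o h), (res_d C 0 \o c); split=> z.
  by rewrite -[LHS]/(pullback_snd (h _)) -hE (proj2 (eE _)).
by rewrite /= -cE /= linearB /= a'E pullback_val subrKC.
Qed.

(** Extended by zero, a is a cocycle on the cocone. That it is the coboundary of (a', b') says a =
    a' d - x b' and b' d = 0. *)
Lemma coh_divisible_cocone N n :
  coh_vanish (cocone x C) N n.+1 -> coh_divisible x C N n.+1.
Proof.
move=> vD a a0.
have [z|c cE] := vD (a \o fst).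
  by rewrite [res_d _ _ z]cocone_dSE /= a0.
have [a' [b' cab]] : exists (a' : {linear C n.+1 -> N})
    (b' : {linear C n.+2 -> N}), forall p, c p = a' p.1 + b' p.2.
  exists (c \o pair_lin idfun \0), (c \o pair_lin \0 idfun).
  exact: copair_lin_eta.
have aE p : a p.1 = a' (res_d C n.+1 p.1) - b' (x *: p.1 + res_d C n.+2 p.2).
  have := cE p; rewrite cab [res_d (cocone x C) n.+1 p]cocone_dSE /= => ->.
  by rewrite (linearN b').
exists (\- b'), a'; split=> z.
  by have := aE (0, z); rewrite /= scaler0 !linear0 !add0r => <-.
have := aE (z, 0); rewrite /= linear0 addr0 => ->.
by rewrite (linearZ_LR b') scalerN addrC.
Qed.

End Descent.

(** * The tensor product with the total ring of fractions, and constant rank *)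

Section TensorUniversal.
Variables (R : comNzRingType) (M N V : lmodType R).

Lemma tensor_pi_rel z : tensor_relation z -> tensor_pi M N z = 0.
Proof. by move=> zR; apply/eqP; rewrite [_ == _]quotmod_pi_eq0 lspan_gen. Qed.

Fact pure_tensor_linearr (u : M) : linear (@pure_tensor R M N u).
Proof.
move=> a v w; have := tensor_pi_rel (TensorDr u (a *: v) w).
have := tensor_pi_rel (TensorZr a u v).
rewrite !(linearB (tensor_pi M N)) (linearZ_LR (tensor_pi M N)).
move=> /eqP; rewrite subr_eq0 => /eqP uv /eqP.
by rewrite -addrA -opprD subr_eq0 uv => /eqP.
Qed.

Fact pure_tensor_linearl (v : N) : linear (fun u => @pure_tensor R M N u v).
Proof.
move=> a u w; have := tensor_pi_rel (TensorDl (a *: u) w v).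
have := tensor_pi_rel (TensorZl a u v).
rewrite !(linearB (tensor_pi M N)) (linearZ_LR (tensor_pi M N)).
move=> /eqP; rewrite subr_eq0 => /eqP uv /eqP.
by rewrite -addrA -opprD subr_eq0 uv => /eqP.
Qed.

Lemma tensor_lift (f : M -> N -> V) :
  (forall u, linear (f u)) -> (forall v, linear (fun u => f u v)) ->
  exists h : {linear tensor M N -> V}, forall u v, h (pure_tensor u v) = f u v.
Proof.
move=> fr fl.
pose fR u := linear_pack (fr u); pose fL v := linear_pack (fl v).
have [g gE] : exists g : {linear {freeg (M * N)%type / R} -> V},
    forall u v, g << (u, v) >> = f u v.
  by exists (fglift (fun p => f p.1 p.2)) => u v; rewrite /= liftU scale1r.
have g0 z : z \in lspan (@tensor_relation R M N) -> g z = 0.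
  move=> /asboolP/(_ (lkernel g)) zg; apply/eqP; apply: zg => w.
  case=> [u u' v|u v v'|a u v|a u v]; apply/eqP;
    rewrite !(linearB g) ?(linearZ_LR g) !gE.
  - by rewrite -[f _ v]/(fL v _) (linearD (fL v)) addrAC addrK subrr.
  - by rewrite -[f u (_ + _)]/(fR u _) (linearD (fR u)) addrAC addrK subrr.
  - by rewrite -[f _ v]/(fL v _) (linearZ_LR (fL v)) subrr.
  - by rewrite -[f u (_ *: _)]/(fR u _) (linearZ_LR (fR u)) subrr.
pose h0 (t : tensor M N) : V := g (repr t).
have h0E z : h0 (tensor_pi M N z) = g z.
  apply/eqP; rewrite -subr_eq0 -linearB; apply/eqP/g0.
  by rewrite -quotmod_piE quotmod_piK.
have h0L : linear h0.
  move=> a t u; rewrite -(quotmod_piK t) -(quotmod_piK u) -linearP /=.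
  by rewrite !h0E linearP.
by exists (linear_pack h0L) => u v; rewrite /= /pure_tensor h0E gE.
Qed.

End TensorUniversal.

Section ConstantRank.
Variables (R : comNzRingType) (x : R) (E : lmodType R) (k : nat).
Variables (f : {linear E -> 'rV[R]_k}) (w : 'I_k -> E).
Hypothesis x_nzd : nonzerodivisor x.
Hypothesis fw : forall i, f (w i) = x *: delta_mx 0 i.
Hypothesis wf : forall e, x *: e = \sum_i f e 0 i *: w i.

Local Notation Q := (totfrac R).
Let ix : Q := tfrac 1 x_nzd.

Let ixE : to_totfrac x * ix = 1.
Proof.
rewrite -[LHS]/(totfrac_mul _ _) tfrac_mul -[RHS]/(totfrac1 R).
by apply/tfracP; rewrite !mulr1 !mul1r.
Qed.

(** Both composites of f with the map given by w are multiplication by x, which is invertible in Q.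
    So f (x) Q has the inverse sending v to the sum of the w_i (x) v_i / x. *)
Lemma torsion_iso_constant_rank : has_constant_rank E k.
Proof.
have /choice[h hE] i : exists h : {linear tensor E Q -> Q},
    forall e q, h (pure_tensor e q) = f e 0 i *: q.
  apply: (tensor_lift (f := fun e q => f e 0 i *: q)).
    by move=> e a p q; rewrite scalerDr !scalerA mulrC.
  by move=> q a e e'; rewrite linearP !mxE scalerDl scalerA.
(* [tensor_lift] yields R-linear maps; Q-linearity is checked on pure tensors. *)
have hZ i q t : h i (tensor_map (totfrac_mull q) t) = q * h i t.
  apply: (tensor_ext (h := h i \o tensor_map (totfrac_mull q))
                     (h' := totfrac_mull q \o h i)) => e p.
  by rewrite /= tensor_map_pure !hE linearZ.
have gL : linear (fun t : totfrac_tensor E => \row_i h i t : 'rV[Q]_k).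
  move=> q t u; apply/rowP => i; rewrite !mxE linearD.
  by congr (_ + _); exact: hZ.
pose g : {linear totfrac_tensor E -> 'rV[Q]_k} := linear_pack gL.
pose l i : {linear Q -> tensor E Q} :=
  linear_pack (pure_tensor_linearr (w i)) \o totfrac_mull ix.
exists g.
exists (fun v : 'rV[Q]_k => \sum_i l i (v 0 i) : totfrac_tensor E) => [t|v].
  have sumL : linear (fun t => \sum_i l i (h i t)).
    move=> a t' u; rewrite scaler_sumr -big_split; apply: eq_bigr => i _ /=.
    by rewrite -(linearP (l i)) -linearP.
  transitivity (linear_pack sumL t).
    by apply: eq_bigr => i _; rewrite mxE.
  apply: (tensor_ext (h' := idfun)) => e q.
  pose r (p : Q) : {linear E -> tensor E Q} :=
    linear_pack (@pure_tensor_linearl R E Q p).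
  (* Moving x across the tensor sign, e (x) q = (x e) (x) (q / x), to which [wf] applies. *)
  transitivity (r (ix * q) (x *: e)).
    rewrite -[LHS]/(\sum_i l i (h i (pure_tensor e q))) wf linear_sum.
    apply: eq_bigr => i _.
    by rewrite hE (linearZ_LR (l i)) (linearZ_LR (r _)).
  rewrite linearZ_LR -(linearZ_LR (linear_pack (pure_tensor_linearr e))) /=.
  by rewrite -[x *: _]/(to_totfrac x * _) mulrA ixE mul1r.
apply/rowP => i; rewrite mxE linear_sum (bigD1 i) //= hE fw !mxE !eqxx mulr1.
rewrite big1 ?addr0 => [|j ji].
  by rewrite -[_ *: _]/(to_totfrac x * (ix * _)) mulrA ixE mul1r.
by rewrite hE fw !mxE eqxx eq_sym (negPf ji) mulr0 scale0r.
Qed.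

End ConstantRank.

(** Identify [C 1] with R^k. The projection E -> C 1 is inverse up to x to v |-> (x v, d v): on (p,
    q) in E the composite is (x p, d p) = x (p, q). *)
Lemma pullback_constant_rank (R : comNzRingType) (x : R) (C : resolution R) k
    (i : {linear C 1 -> 'rV[R]_k}) (j : {linear 'rV[R]_k -> C 1}) :
  nonzerodivisor x -> cancel i j -> cancel j i ->
  has_constant_rank (pullback x C) k.
Proof.
move=> x_nzd ij ji.
have [v|w wE] := pullback_pair (x := x) (C := C) (f := x \*: j)
    (g := res_d C 0 \o j).
  by rewrite /= linearZ_LR.
apply: (torsion_iso_constant_rank (f := i \o pullback_fst x C)
  (w := fun l => w (delta_mx 0 l)) x_nzd) => [l|e].
  by rewrite -[LHS]/(i (pullback_fst x C _)) (proj1 (wE _)) linearZ_LR /= ji.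
rewrite -[RHS](row_lin_sum w); have [w1 w2] := wE (i (pullback_fst x C e)).
apply: pullback_inj; rewrite ?w1 ?w2 linearZ_LR /= ij //.
by rewrite -pullback_val.
Qed.

(** * Positive depth and the equivalence of the two conditions *)

Lemma depth_nonzerodivisor (R : comNzRingType) (m : set R) d :
  has_depth m d -> (0 < d)%N -> exists x, m x /\ nonzerodivisor x.
Proof.
move=> [[s [[_ sreg] sm] <-] _] s_gt0; exists s`_0; split.
  exact/sm/mem_nth.
move=> a sa; have [c ->] : ideal_gen (take 0 s) a.
  by apply: sreg => //; rewrite sa take0; exists (fun=> 0); rewrite big_ord0.
by rewrite big1 // => i; have := ltn_ord i; rewrite {2}take0.
Qed.

Theorem corollary2p6 (R : comNzRingType) (m : set R) (d : nat) :
  noetherian R -> local_ring m -> has_depth m d -> (0 < d)%N ->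
  (SAC R <-> SACC R).
Proof.
move=> noethR locR depthR d_gt0.
split=> [sac M fgM _|sacc M fgM MR [k MM]]; first exact: sac.
have [x [mx x_nzd]] := depth_nonzerodivisor depthR d_gt0.
pose C := fg_resolution noethR fgM.
pose D := cocone x C; pose E := pullback x C.
(* [C 0] reduces to M and [D 0] to E, so C and D compute the Ext modules of M and E. *)
have CR n : coh_vanish C R^o n.+1 by apply/(Ext_coh_vanish C); exact: MR.
have CM n : (k <= n.+1)%N -> coh_vanish C M n.+1.
  by move=> kn; apply/(Ext_coh_vanish C); exact: MM.
have DR n : coh_vanish D R^o n.+1 by apply: cocone_coh_vanish; exact: CR.
have DF n : coh_vanish D (C 1) n.+1 by exact/coh_vanish_row/DR.
have DM n : (k <= n.+1)%N -> coh_vanish D M n.+1.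
  move=> kn; apply: cocone_coh_vanish; apply: CM => //.
  exact: leq_trans kn (leqnSn _).
have noethM := fg_noetherian_module noethR fgM.
have noethC n : noetherian_module (C n.+1) by exact: noetherian_module_row.
have fgE : finitely_generated E.
  apply/noetherian_module_fg/(noetherian_module_inj (@lkernel_val_inj _ _ _ _)).
  exact: (noetherian_module_prod (noethC 0%N) noethM).
have rankE : exists r, has_constant_rank E r.
  exists (size (generators M)).
  exact: (@pullback_constant_rank R x C _ idfun idfun).
have ER i : (0 < i)%N -> zero_module (Ext i E R^o).
  by case: i => // n _; apply/(Ext_coh_vanish D).
(* The bound [k.+2] forces i = n + 2, the form in [coh_vanish_pullback], and keeps the degree i - 1
   used there at least k. *)
have EE i : (k.+2 <= i)%N -> zero_module (Ext i E E).
  case: i => [|[|n]] // kn; apply/(Ext_coh_vanish D).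
  apply: coh_vanish_pullback; [apply: DM|exact: DF|apply: DM].
    by rewrite ltnW.
  by rewrite ltnW // ltnW.
have DE n : coh_vanish D E n.+1.
  apply/(Ext_coh_vanish D); apply: (sacc E fgE _ ER _ n.+1) => //.
  by exists k.+2.
(* Vanishing of Ext(E, M) is improved from large degrees to all positive ones. *)
have {}DM n : coh_vanish D M n.+1.
  apply: (coh_divisible_vanish (x := x) locR mx _ noethM).
    exact/noetherian_module_fg/noetherian_module_prod.
  exact: (coh_divisible_pullback (C := C) (DE _) (DF _)).
case=> // n _; apply/(Ext_coh_vanish C).
(* The second use of Nakayama's lemma descends from D to C. *)
apply: (coh_divisible_vanish (x := x) locR mx _ noethM).
  exact: noetherian_module_fg.
by apply: coh_divisible_cocone; exact: DM.
Qed.
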